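(* Let $\mathcal{P}$ be a finite regular polyhedron in $\mathbb{E}^3$ whose symmetry group $G(\mathcal{P})$ is the icosahedral group $[3,5]$. Then there is no rank-$3$ lattice group $\mathbf{\Lambda}$ on $\mathbb{E}^3$ such that the quotient map $\pi_{\mathbf{\Lambda}}:\mathbb{E}^3\to\mathbb{T}^3_{\mathbf{\Lambda}}$ induces a symmetric toroidal realization of a regular polyhedron.
   Context: Isometries act on the right. Polyhedra. A polyhedron $\mathcal{P}$ is a connected graph (its $1$-skeleton, parallel edges allowed) together with a family of subgraphs called faces such that every edge lies in at least one face, every face is a connected $2$-valent graph, and every vertex figure (the graph whose nodes are the edges at a given vertex, two being adjacent when they belong to a common face) is a connected $2$-valent graph; equivalently, a rank-$3$ abstract polytope. A flag is a mutually incident triple (vertex, edge, face). $\mathcal{P}$ is regular if its automorphism group $\Gamma(\mathcal{P})$ acts transitively on flags. Regular polyhedra in $\mathbb{E}^3$. A regular polyhedron in $\mathbb{E}^3$ is a regular polyhedron whose vertices are points of $\mathbb{E}^3$ forming a discrete set, whose edges are the line segments joining the two endpoints and whose faces are collections of such segments (distinct vertices, edges, faces of $\mathcal{P}$ giving distinct points, segments, collections), such that every automorphism is induced by an isometry of $\mathbb{E}^3$. $G(\mathcal{P})$ denotes its group of symmetries, generated by isometries $R_0,R_1,R_2$ inducing the distinguished automorphisms ($R_i$ sends the base flag to the flag differing from it exactly in the element of rank $i$). $[3,5]$ is the full symmetry group, of order $120$, of a regular icosahedron. Lattices and tori. A rank-$3$ lattice group $\mathbf{\Lambda}$ is a group of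 translations generated by three linearly independent translations; $\mathbb{T}^3_{\mathbf{\Lambda}}=\mathbb{E}^3/\mathbf{\Lambda}$ with the quotient metric, and $\pi_{\mathbf{\Lambda}}$ is the quotient map. An isometry $S$ of $\mathbb{E}^3$ induces an isometry $\overline{S}$ of $\mathbb{T}^3_{\mathbf{\Lambda}}$ if $\pi_{\mathbf{\Lambda}}(xS)=\pi_{\mathbf{\Lambda}}(x)\overline{S}$ for all $x$. Toroidal realizations. A graph in $\mathbb{T}^3_{\mathbf{\Lambda}}$ is a set of points (vertices) with a set of geodesic arcs (edges), each having two distinct vertices as endpoints and no vertex in its interior. ''$\pi_{\mathbf{\Lambda}}$ induces a symmetric toroidal realization of a regular polyhedron $\mathcal{P}_{\mathbf{\Lambda}}$'' means: the images under $\pi_{\mathbf{\Lambda}}$ of the vertices and edges of $\mathcal{P}$ form a graph in $\mathbb{T}^3_{\mathbf{\Lambda}}$; this graph, together with the images of the faces of $\mathcal{P}$ as faces, is a regular polyhedron $\mathcal{P}_{\mathbf{\Lambda}}$; and the isometries $R_0,R_1,R_2$ of $\mathbb{E}^3$ generating $G(\mathcal{P})$ induce isometries of $\mathbb{T}^3_{\mathbf{\Lambda}}$, through which all automorphisms of $\mathcal{P}_{\mathbf{\Lambda}}$ are realized. *)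

(* Defs.v *)
From Stdlib Require Import Relation_Operators.
From mathcomp Require Import all_boot all_order all_algebra.
From mathcomp Require Import generic_quotient ring_quotient.
From mathcomp Require Import all_classical all_reals.
From mathcomp Require Import topology normedtype.

Set Implicit Arguments.
Unset Strict Implicit.
Unset Printing Implicit Defensive.

Import Order.TTheory GRing.Theory Num.Theory.
Import numFieldNormedType.Exports.

Local Open Scope classical_set_scope.
Local Open Scope ring_scope.

Definition is_pair (T : Type) (A : set T) : Prop :=
  exists a b, a <> b /\ A = [set a; b].

Record multigraph := Multigraph {
  node : Type;
  link : Type;
  link_ends : link -> set node }.

Definition loopless (G : multigraph) : Prop :=
  forall l : link G, is_pair (link_ends l).

Definition adjacent (G : multigraph) (x y : node G) : Prop :=
  exists l : link G, link_ends l x /\ link_ends l y.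

Definition connected_graph (G : multigraph) : Prop :=
  inhabited (node G) /\
  forall x y : node G, clos_refl_trans (node G) (@adjacent G) x y.

Definition two_valent (G : multigraph) : Prop :=
  forall x : node G, is_pair [set l : link G | link_ends l x].

Definition connected_two_valent_graph (G : multigraph) : Prop :=
  [/\ loopless G, connected_graph G & two_valent G].

Record prepolyhedron := Prepolyhedron {
  vert : Type;
  edge : Type;
  face : Type;
  ends : edge -> set vert;
  face_verts : face -> set vert;
  face_edges : face -> set edge }.

Section Polyhedron.
Variable P : prepolyhedron.

Definition skeleton : multigraph := Multigraph (@ends P).

Definition face_graph (f : face P) : multigraph :=
  @Multigraph (set_type (face_verts f)) (set_type (face_edges f))
    (fun e => [set v | ends (val e) (val v)]).

(* The links are the faces at [v], so that two edges at [v] that lie in two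
   common faces are joined by two parallel links; this is what makes the notion
   agree with rank-3 abstract polytopes when a vertex has degree 2. *)
Definition vertex_figure (v : vert P) : multigraph :=
  @Multigraph (set_type [set e : edge P | ends e v])
    (set_type [set f : face P | face_verts f v])
    (fun f => [set e | face_edges (val f) (val e)]).

Definition is_polyhedron : Prop :=
  [/\ loopless skeleton /\ connected_graph skeleton,
      (forall (f : face P) (e : edge P),
         face_edges f e -> ends e `<=` face_verts f),
      (forall e : edge P, exists f : face P, face_edges f e),
      (forall f : face P, connected_two_valent_graph (face_graph f)) &
      (forall v : vert P, connected_two_valent_graph (vertex_figure v))].

Record automorphism := Automorphism {
  aut_vert : vert P -> vert P;
  aut_edge : edge P -> edge P;
  aut_face : face P -> face P;
  aut_vert_bij : bijective aut_vert;
  aut_edge_bij : bijective aut_edge;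
  aut_face_bij : bijective aut_face;
  aut_ends : forall e v, ends (aut_edge e) (aut_vert v) <-> ends e v;
  aut_face_verts : forall f v,
    face_verts (aut_face f) (aut_vert v) <-> face_verts f v;
  aut_face_edges : forall f e,
    face_edges (aut_face f) (aut_edge e) <-> face_edges f e }.

Definition is_flag (v : vert P) (e : edge P) (f : face P) : Prop :=
  [/\ ends e v, face_edges f e & face_verts f v].

Definition flag_transitive : Prop :=
  forall v e f v' e' f', is_flag v e f -> is_flag v' e' f' ->
  exists a : automorphism,
    [/\ aut_vert a v = v', aut_edge a e = e' & aut_face a f = f'].

Definition is_regular_polyhedron : Prop := is_polyhedron /\ flag_transitive.

End Polyhedron.

(* An arc is a point set together with the set of its endpoints. *)
Record geom_arc (X : Type) := Arc { locus : set X; endpoints : set X }.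

Record figure (X : Type) := Figure {
  fig_verts : set X;
  fig_edges : set (geom_arc X);
  fig_faces : set (set (geom_arc X)) }.

Definition arc_image (X Y : Type) (h : X -> Y) (A : geom_arc X) : geom_arc Y :=
  Arc (h @` locus A) (h @` endpoints A).

Definition face_image (X Y : Type) (h : X -> Y) (f : set (geom_arc X)) :
  set (geom_arc Y) := arc_image h @` f.

Definition figure_image (X Y : Type) (h : X -> Y) (P : figure X) : figure Y :=
  Figure (h @` fig_verts P) (arc_image h @` fig_edges P)
         (face_image h @` fig_faces P).

(* The vertices of a face, viewed as a subgraph, are the endpoints of the
   edges in the collection. *)
Definition underlying (X : Type) (P : figure X) : prepolyhedron :=
  @Prepolyhedron (set_type (fig_verts P)) (set_type (fig_edges P))
    (set_type (fig_faces P))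
    (fun e => [set v | endpoints (val e) (val v)])
    (fun f => [set v | exists2 A, (val f) A & endpoints A (val v)])
    (fun f => [set e | (val f) (val e)]).

Definition realizes (X : Type) (P : figure X) (S : X -> X)
    (a : automorphism (underlying P)) : Prop :=
  [/\ forall v, val (aut_vert a v) = S (val v),
      forall e, val (aut_edge a e) = arc_image S (val e) &
      forall f, val (aut_face a f) = face_image S (val f)].

Definition finite_figure (X : Type) (P : figure X) : Prop :=
  [/\ finite_set (fig_verts P), finite_set (fig_edges P)
    & finite_set (fig_faces P)].

Definition is_isometry (R : realType) (X : Type) (d : X -> X -> R) (S : X -> X) :
  Prop := bijective S /\ forall x y, d (S x) (S y) = d x y.

Definition transformation_group (X : Type) (H : set (X -> X)) : Prop :=
  [/\ H id,
      (forall S T, H S -> H T -> H (S \o T)) &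
      (forall S T, H S -> cancel S T -> cancel T S -> H T)].

Definition generated_group (X : Type) (D : set (X -> X)) : set (X -> X) :=
  smallest (@transformation_group X) D.

Section Euclidean.
Variable R : realType.
Notation E3 := 'rV[R]_3.

(* The norm that the library puts on matrices is the maximum norm. *)
Definition euclid_dist (x y : E3) : R :=
  Num.sqrt (\sum_(i < 3) (x 0 i - y 0 i) ^+ 2).

Definition segment (a b : E3) : set E3 :=
  [set (1 - t) *: a + t *: b | t in `[0, 1]].

Definition segment_arc (a b : E3) : geom_arc E3 := Arc (segment a b) [set a; b].

(* Distinct vertices, edges and faces give distinct points, segments and
   collections because a figure consists of sets of these. *)
Definition regular_polyhedron_E3 (P : figure E3) : Prop :=
  [/\ is_regular_polyhedron (underlying P),
      fig_verts P `<=` isolated (fig_verts P),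
      (forall A, fig_edges P A -> exists a b,
         [/\ fig_verts P a, fig_verts P b, a <> b & A = segment_arc a b]),
      (forall f, fig_faces P f -> f `<=` fig_edges P) &
      (forall a : automorphism (underlying P),
         exists2 S, is_isometry euclid_dist S & realizes S a)].

Definition symmetry_group (P : figure E3) : set (E3 -> E3) :=
  [set S | is_isometry euclid_dist S /\ figure_image S P = P].

Definition distinguished_generators (P : figure E3) (R0 R1 R2 : E3 -> E3) :
  Prop :=
  [/\ generated_group [set R0; R1; R2] = symmetry_group P &
      exists v e f,
        [/\ fig_verts P v, fig_edges P e, fig_faces P f, endpoints e v & f e]
        /\
        [/\ [/\ R0 v <> v, arc_image R0 e = e & face_image R0 f = f],
            [/\ R1 v = v, arc_image R1 e <> e & face_image R1 f = f] &
            [/\ R2 v = v, arc_image R2 e = e & face_image R2 f <> f]]].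

Definition golden_ratio : R := (1 + Num.sqrt 5) / 2.

(* The cyclic permutations of (0, +-1, +-golden_ratio); the indices k + 1 and
   k + 2 are taken modulo 3. *)
Definition standard_icosahedron : set E3 :=
  [set x | exists (k : 'I_3) (s t : bool),
     [/\ x 0 k = 0, x 0 (k + 1) = (-1) ^+ s &
         x 0 (k + 2) = (-1) ^+ t * golden_ratio]].

Definition regular_icosahedron (A : set E3) : Prop :=
  exists (c : R) (S : E3 -> E3),
    [/\ 0 < c, is_isometry euclid_dist S &
        A = [set S (c *: x) | x in standard_icosahedron]].

Definition icosahedral_group (G : set (E3 -> E3)) : Prop :=
  exists2 A, regular_icosahedron A &
             G = [set S | is_isometry euclid_dist S /\ S @` A = A].

(* A group of translations is identified with its group of translation
   vectors. *)
Definition rank3_lattice_group (L : zmodClosed E3) : Prop :=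
  exists2 B : 'M[R]_3, B \in unitmx &
    forall x : E3, x \in L <-> exists z : 'rV[int]_3, x = map_mx intr z *m B.

Definition torus (L : zmodClosed E3) : Type := Quotient.quot L.

Definition torus_proj (L : zmodClosed E3) (x : E3) : torus L :=
  (\pi_(Quotient.quot L) x)%qT.

Definition torus_dist (L : zmodClosed E3) (p q : torus L) : R :=
  inf [set euclid_dist x y | x in @torus_proj L @^-1` [set p]
                     & y in @torus_proj L @^-1` [set q]].

Definition induces (L : zmodClosed E3) (S : E3 -> E3) (S' : torus L -> torus L) :
  Prop := forall x, torus_proj L (S x) = S' (torus_proj L x).

(* Geodesics of a flat torus are the projections of straight lines. *)
Definition geodesic_arc (L : zmodClosed E3) (A : geom_arc (torus L)) : Prop :=
  exists a b : E3,
    [/\ a <> b, set_inj (segment a b) (@torus_proj L) &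
        A = arc_image (@torus_proj L) (segment_arc a b)].

Definition torus_graph (L : zmodClosed E3) (V : set (torus L))
    (E : set (geom_arc (torus L))) : Prop :=
  forall A, E A ->
    [/\ geodesic_arc A, endpoints A `<=` V &
        (locus A `\` endpoints A) `&` V = set0].

Definition symmetric_toroidal_realization (P : figure E3) (L : zmodClosed E3) :
  Prop :=
  let PL := figure_image (@torus_proj L) P in
  [/\ torus_graph (fig_verts PL) (fig_edges PL),
      is_regular_polyhedron (underlying PL) &
      exists R0 R1 R2 S0 S1 S2,
        [/\ distinguished_generators P R0 R1 R2,
            [/\ is_isometry (@torus_dist L) S0, is_isometry (@torus_dist L) S1
              & is_isometry (@torus_dist L) S2],
            [/\ induces R0 S0, induces R1 S1 & induces R2 S2] &
            forall a : automorphism (underlying PL),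
              exists2 S, generated_group [set S0; S1; S2] S & realizes S a]].

End Euclidean.

(* Main.v *)
Require Import Defs.
From mathcomp Require Import all_boot all_order all_algebra.
From mathcomp Require Import ring_quotient zify ring.
From mathcomp Require Import all_classical all_reals.

(** This is the crystallographic restriction.  If the generators of [G(P)]
    induce isometries of the torus E^3/L, then every element of [G(P)]
    preserves and reflects congruence of points modulo [L], because this
    property passes to products and inverses ([lattice_compatible_group]).
    Hence the linear part of every symmetry maps [L] into itself; in a basis of
    [L] it is an integer matrix, and its trace is an integer
    ([lattice_trace_int]).

    On the other hand the icosahedral group contains a rotation through 72
    degrees.  Its linear part has trace 1 + 2 cos 72, which is the golden ratio
    and so not an integer ([golden_ratio_not_int]).  Concretely, it is built as
    the product of the reflections in two mirrors of the standard icosahedron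
    that meet at 36 degrees ([icosahedron_rotation_trace]), then transported to
    the given icosahedron by the similarity between the two.  The isometry part
    of this similarity is only known to preserve distances;
    [norm_preserving_affine] shows that it is affine, so that the transported
    rotation has a linear part, conjugate to that of the original one and
    therefore of the same trace. *)

Set Implicit Arguments.
Unset Strict Implicit.
Unset Printing Implicit Defensive.

Import Order.TTheory GRing.Theory Num.Theory.

Local Open Scope classical_set_scope.
Local Open Scope ring_scope.

(** * Inner products, isometries of row space and reflections *)

Section DotProduct.
Variables (R : realFieldType) (n : nat).
Implicit Types (x y a : 'rV[R]_n) (Q : 'M[R]_n).

Definition dot x y : R := (x *m y^T) 0 0.

Lemma dotE x y : dot x y = \sum_i x 0 i * y 0 i.
Proof. by rewrite /dot mxE; apply: eq_bigr => i _; rewrite mxE. Qed.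

Lemma dotC x y : dot x y = dot y x.
Proof. by rewrite !dotE; apply: eq_bigr => i _; rewrite mulrC. Qed.

Lemma dotBl x y a : dot (x - y) a = dot x a - dot y a.
Proof. by rewrite !dotE -sumrB; apply: eq_bigr => i _; rewrite !mxE mulrBl. Qed.

Lemma dotZl c x y : dot (c *: x) y = c * dot x y.
Proof.
by rewrite !dotE mulr_sumr; apply: eq_bigr => i _; rewrite mxE mulrA.
Qed.

Lemma dot_polar x y : dot x y = (dot x x + dot y y - dot (x - y) (x - y)) / 2.
Proof.
by rewrite !dotBl !(dotC _ (x - y)) !dotBl (dotC y x); field.
Qed.

Lemma dot_mul_orthogonal Q x y :
  Q *m Q^T = 1%:M -> dot (x *m Q) (y *m Q) = dot x y.
Proof. by move=> QQ; rewrite /dot trmx_mul mulmxA -(mulmxA x) QQ mulmx1. Qed.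

(** The images of the standard basis are the rows of the matrix [Q]; as they
    are orthonormal, the coordinates of [S x - S 0] with respect to them are
    its inner products with them, which [S] preserves. *)
Lemma norm_preserving_affine (S : 'rV[R]_n -> 'rV[R]_n) :
  (forall x y, dot (S x - S y) (S x - S y) = dot (x - y) (x - y)) ->
  exists2 Q : 'M[R]_n, Q *m Q^T = 1%:M & forall x, S x = x *m Q + S 0.
Proof.
move=> Siso.
have Sdot x y : dot (S x - S 0) (S y - S 0) = dot x y.
  rewrite dot_polar [RHS]dot_polar.
  have -> : S x - S 0 - (S y - S 0) = S x - S y by rewrite opprB addrA subrK.
  by rewrite !Siso !subr0.
pose Q := \matrix_(i < n) (S (delta_mx 0 i) - S 0).
have SQ x : (S x - S 0) *m Q^T = x.
  apply/rowP => j; transitivity (dot (S x - S 0) (S (delta_mx 0 j) - S 0)).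
    by rewrite dotE mxE; apply: eq_bigr => i _; rewrite !mxE.
  by rewrite Sdot /dot trmx_delta -colE mxE.
have QQ : Q *m Q^T = 1%:M.
  by apply/row_matrixP => i; rewrite row_mul rowK SQ row1.
exists Q => // x; apply/eqP; rewrite -subr_eq; apply/eqP.
by rewrite -{2}(SQ x) -mulmxA (mulmx1C QQ) mulmx1.
Qed.

Definition reflection a : 'M[R]_n := 1%:M - 2 *: (a^T *m a).

Lemma mul_reflection a x : x *m reflection a = x - (2 * dot x a) *: a.
Proof.
rewrite /reflection mulmxBr mulmx1 -scalemxAr mulmxA -scalerA.
by rewrite [x *m a^T]mx11_scalar mul_scalar_mx.
Qed.

Lemma reflection_tr a : (reflection a)^T = reflection a.
Proof. by rewrite /reflection linearB linearZ /= trmx1 trmx_mul trmxK. Qed.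

Lemma reflectionK a : dot a a = 1 -> reflection a *m reflection a = 1%:M.
Proof.
move=> a1; apply/row_matrixP => i; rewrite row_mul !rowE mulmx1.
rewrite !mul_reflection dotBl dotZl a1 -addrA -opprD -scalerDl.
by rewrite [X in X *: a](_ : _ = 0) ?scale0r ?subr0 //; ring.
Qed.

(** The product of two reflections is the rotation through twice the angle
    between their mirrors, whose trace is determined by the cosine
    [dot a b]. *)
Lemma mxtrace_mul_reflection a b : dot a a = 1 -> dot b b = 1 ->
  \tr (reflection a *m reflection b) = n%:R - 4 + 4 * dot a b ^+ 2.
Proof.
have trM (M : 'M_n) c : \tr (M *m reflection c) = \tr M - 2 * dot (c *m M) c.
  rewrite mulmxBr mulmx1 -scalemxAr linearB linearZ /= mulmxA mxtrace_mulC.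
  by rewrite [in LHS]mulmxA /mxtrace big_ord1.
move=> a1 b1; rewrite trM -[X in \tr X - _]mul1mx trM mxtrace1 mulmx1 a1.
by rewrite mul_reflection dotBl dotZl b1 (dotC b a); ring.
Qed.

End DotProduct.

(** * Isometries of Euclidean space *)

Section Isometries.
Variable R : realType.
Notation E3 := 'rV[R]_3.
Implicit Types (S T : E3 -> E3) (Q : 'M[R]_3).

Lemma euclid_distE (x y : E3) :
  euclid_dist x y = Num.sqrt (dot (x - y) (x - y)).
Proof.
rewrite /euclid_dist dotE; congr Num.sqrt.
by apply: eq_bigr => i _; rewrite !mxE expr2.
Qed.

Lemma isometry_affine S : is_isometry (@euclid_dist R) S ->
  exists2 Q : 'M[R]_3, Q *m Q^T = 1%:M & forall x, S x = x *m Q + S 0.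
Proof.
case=> _ Siso; apply: norm_preserving_affine => x y.
have dot_ge0 (z : E3) : 0 <= dot z z.
  by rewrite dotE sumr_ge0 // => i _; rewrite -expr2 sqr_ge0.
by apply/eqP; rewrite -eqr_sqrt //; apply/eqP; rewrite -!euclid_distE Siso.
Qed.

Lemma orthogonal_isometry Q :
  Q *m Q^T = 1%:M -> is_isometry (@euclid_dist R) (mulmxr Q).
Proof.
move=> QQ; split=> [|x y].
  exists (mulmxr Q^T) => x /=; first by rewrite -mulmxA QQ mulmx1.
  by rewrite -mulmxA (mulmx1C QQ) mulmx1.
by rewrite !euclid_distE /= -mulmxBl dot_mul_orthogonal.
Qed.

Lemma isometry_comp S T : is_isometry (@euclid_dist R) S ->
  is_isometry (@euclid_dist R) T -> is_isometry (@euclid_dist R) (S \o T).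
Proof.
move=> [Sbij Siso] [Tbij Tiso]; split; first exact: bij_comp.
by move=> x y /=; rewrite Siso Tiso.
Qed.

Lemma isometry_inv S T : cancel S T -> cancel T S ->
  is_isometry (@euclid_dist R) S -> is_isometry (@euclid_dist R) T.
Proof.
move=> ST TS [_ Siso]; split; first by exists S.
by move=> x y; rewrite -Siso !TS.
Qed.

End Isometries.

(** * Lattices and the maps that descend to the torus *)

Section Lattices.
Variable R : realType.
Notation E3 := 'rV[R]_3.
Implicit Type L : zmodClosed E3.

(** The equivalence, rather than the implication from right to left alone, is
    what makes the class closed under inverses. *)
Definition lattice_compatible L : set (E3 -> E3) :=
  [set S | forall x y, (S x - S y \in L) = (x - y \in L)].

Lemma lattice_compatible_group L :
  transformation_group (lattice_compatible L).
Proof.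
split=> //= [S T SL TL|S T SL _ TS] x y /=; first by rewrite SL TL.
by rewrite -SL !TS.
Qed.

Lemma torus_projE L x y :
  (torus_proj L x = torus_proj L y) <-> (x - y \in L).
Proof. by rewrite Quotient.idealrBE; split=> /eqP. Qed.

Lemma induces_compatible L S S' :
  injective S' -> induces (L := L) S S' -> lattice_compatible L S.
Proof.
move=> S'inj SS' x y; apply/idP/idP => /torus_projE xy; apply/torus_projE.
  by apply: S'inj; rewrite -!SS'.
by rewrite !SS' xy.
Qed.

(** In a basis of the lattice, [M] has integer entries, and the trace does not
    depend on the basis. *)
Lemma lattice_trace_int L (M : 'M[R]_3) : rank3_lattice_group L ->
  (forall x, x \in L -> x *m M \in L) -> exists k : int, \tr M = k%:~R.
Proof.
case=> B Bunit LE LM.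
have /choice[z zE] i : exists z : 'rV[int]_3, row i B *m M = map_mx intr z *m B.
  by apply/LE/LM/LE; exists (delta_mx 0 i); rewrite map_delta_mx -rowE.
pose Z := \matrix_i z i.
have BM : B *m M = map_mx intr Z *m B.
  by apply/row_matrixP => i; rewrite !row_mul zE -map_row rowK.
exists (\tr Z); rewrite -[M](mulKmx Bunit) BM mxtrace_mulC mulmxK //.
by rewrite trace_map_mx.
Qed.

End Lattices.

(** * A five-fold rotation of the icosahedron *)

Section Icosahedron.
Variable R : realType.
Notation E3 := 'rV[R]_3.
Notation phi := (golden_ratio R).

Lemma golden_ratio_sqr : phi ^+ 2 = phi + 1.
Proof.
have : Num.sqrt 5 ^+ 2 = 5 :> R by rewrite sqr_sqrtr.
by rewrite /golden_ratio => s5; field: s5.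
Qed.

(** An integer [k] cannot satisfy [k (k - 1) = 1]. *)
Lemma golden_ratio_not_int (k : int) : phi <> k%:~R.
Proof.
move=> phik; have := golden_ratio_sqr.
rewrite phik -[1]/(1%:~R) expr2 -intrM -intrD => /intr_inj kE.
have : (k <= -1) || (k == 0) || (k == 1) || (2 <= k) by lia.
by nia.
Qed.

Definition row3 (a b c : R) : E3 := \row_j [:: a; b; c]`_j.

Lemma dot_row3 a b c a' b' c' :
  dot (row3 a b c) (row3 a' b' c') = a * a' + b * b' + c * c'.
Proof. by rewrite dotE !big_ord_recl big_ord0 !mxE /= addr0 addrA. Qed.

Lemma row3_eta (x : E3) : x = row3 (x 0 0) (x 0 1) (x 0 2).
Proof.
by apply/rowP => -[[|[|[|//]]] lt_i]; rewrite mxE /=; congr (x _ _);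
   apply: val_inj.
Qed.

Lemma mul_reflection_row3 a b c a' b' c' :
  let u := 2 * (a * a' + b * b' + c * c') in
  row3 a b c *m reflection (row3 a' b' c') =
  row3 (a - u * a') (b - u * b') (c - u * c').
Proof.
rewrite /= mul_reflection dot_row3; apply/rowP => -[[|[|[|//]]] lt_i];
  by rewrite !mxE.
Qed.

(** Listing the three cyclic patterns explicitly removes the arithmetic of
    indices modulo 3 from the computations with vertices. *)
Lemma standard_icosahedronP (x : E3) : standard_icosahedron x <->
  exists s t : bool,
    [\/ x = row3 0 ((-1) ^+ s) ((-1) ^+ t * phi),
        x = row3 ((-1) ^+ t * phi) 0 ((-1) ^+ s) |
        x = row3 ((-1) ^+ s) ((-1) ^+ t * phi) 0].
Proof.
have i3 : (1 + 1 = 2 :> 'I_3) * (1 + 2 = 0 :> 'I_3) * (2 + 1 = 0 :> 'I_3) *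
    (2 + 2 = 1 :> 'I_3) by do !split; apply: val_inj.
split=> [[k [s [t [xk xk1 xk2]]]]|[s [t]]].
  exists s, t; rewrite (row3_eta x).
  have [kE|kE|kE] : [\/ k = 0, k = 1 | k = 2].
  - by case: k {xk xk1 xk2} => [[|[|[|//]]] ?]; [constructor 1|constructor 2|
       constructor 3]; apply: val_inj.
  - by constructor 1; rewrite kE !add0r in xk xk1 xk2; rewrite xk xk1 xk2.
  - by constructor 2; rewrite kE !i3 in xk xk1 xk2; rewrite xk xk1 xk2.
  - by constructor 3; rewrite kE !i3 in xk xk1 xk2; rewrite xk xk1 xk2.
by case=> ->; [exists 0|exists 1|exists 2]; exists s, t;
   rewrite ?add0r ?i3 !mxE.
Qed.

(** Unit normals of two mirrors of the icosahedron, that is, unit vectors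
    pointing to the midpoints of two edges: the edge from (0, 1, phi) to
    (phi, 0, 1) and the edge from (0, 1, phi) to (0, -1, phi).  Their inner
    product is phi / 2 = cos 36. *)
Definition mirror1 : E3 := row3 (1 / 2) ((phi - 1) / 2) (phi / 2).
Definition mirror2 : E3 := row3 0 0 1.

Lemma mirror1_unit : dot mirror1 mirror1 = 1.
Proof. by rewrite dot_row3; field: golden_ratio_sqr. Qed.

Lemma mirror2_unit : dot mirror2 mirror2 = 1.
Proof. by rewrite dot_row3; ring. Qed.

Definition icosahedron_rotation : 'M[R]_3 :=
  reflection mirror1 *m reflection mirror2.

Lemma icosahedron_rotation_trace : \tr icosahedron_rotation = phi.
Proof.
rewrite mxtrace_mul_reflection ?mirror1_unit ?mirror2_unit // dot_row3.
by field: golden_ratio_sqr.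
Qed.

(** The vertices orthogonal to the normal, namely those of the last two
    patterns with opposite signs, are fixed; every other vertex is exchanged
    with one of a different pattern. *)
Lemma mirror1_icosahedron x : standard_icosahedron x ->
  standard_icosahedron (x *m reflection mirror1).
Proof.
have phi2 := golden_ratio_sqr.
move=> /standard_icosahedronP[s [t xE]]; apply/standard_icosahedronP.
case: xE => ->; rewrite mul_reflection_row3.
- have [->|] := eqVneq s t.
    exists (~~ t), (~~ t); constructor 2.
    by case: t; congr row3; rewrite /=; field: phi2.
  case: s t => [] [] // _.
    by exists true, true; constructor 3; congr row3; rewrite /=; field: phi2.
  by exists false, false; constructor 3; congr row3; rewrite /=; field: phi2.
- have [->|] := eqVneq s t.
    exists (~~ t), (~~ t); constructor 1.
    by case: t; congr row3; rewrite /=; field: phi2.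
  move=> st; exists s, t; constructor 2.
  by case: s t st => [] [] // _; congr row3; rewrite /=; field: phi2.
- have [->|] := eqVneq s t.
    exists t, (~~ t); constructor 1.
    by case: t; congr row3; rewrite /=; field: phi2.
  move=> st; exists s, t; constructor 3.
  by case: s t st => [] [] // _; congr row3; rewrite /=; field: phi2.
Qed.

Lemma mirror2_icosahedron x : standard_icosahedron x ->
  standard_icosahedron (x *m reflection mirror2).
Proof.
move=> /standard_icosahedronP[s [t xE]]; apply/standard_icosahedronP.
case: xE => ->; rewrite mul_reflection_row3.
- by exists s, (~~ t); constructor 1; case: t; congr row3; rewrite /=; ring.
- by exists (~~ s), t; constructor 2; case: s; congr row3; rewrite /=; ring.
- by exists s, t; constructor 3; congr row3; rewrite /=; ring.
Qed.

Lemma icosahedron_rotation_orthogonal :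
  icosahedron_rotation *m icosahedron_rotation^T = 1%:M.
Proof.
rewrite /icosahedron_rotation trmx_mul !reflection_tr mulmxA.
rewrite -(mulmxA (reflection mirror1)).
by rewrite (reflectionK mirror2_unit) mulmx1 (reflectionK mirror1_unit).
Qed.

Lemma icosahedron_rotation_stable :
  mulmxr icosahedron_rotation @` standard_icosahedron (R := R) =
  standard_icosahedron (R := R).
Proof.
rewrite eqEsubset; split=> [_ [x Ix <-]|x Ix] /=.
  by rewrite mulmxA; apply/mirror2_icosahedron/mirror1_icosahedron.
exists (x *m reflection mirror2 *m reflection mirror1) => /=.
  exact/mirror1_icosahedron/mirror2_icosahedron.
rewrite /icosahedron_rotation mulmxA -(mulmxA (x *m reflection mirror2)).
rewrite (reflectionK mirror1_unit) mulmx1 -mulmxA.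
by rewrite (reflectionK mirror2_unit) mulmx1.
Qed.

(** Multiplication by a matrix commutes with the scaling by [c], so conjugating
    by the isometry [T] alone already turns the rotation of the standard
    icosahedron into a symmetry of the given one. *)
Lemma icosahedral_group_rotation (G : set (E3 -> E3)) : icosahedral_group G ->
  exists T T' : E3 -> E3,
    [/\ is_isometry (@euclid_dist R) T, cancel T' T &
        G (T \o mulmxr icosahedron_rotation \o T')].
Proof.
case=> A [c [T [c0 Tiso ->]]] ->; have [[T' TT' T'T] _] := Tiso.
exists T, T'; split=> //; split.
  apply: isometry_comp (isometry_inv TT' T'T Tiso).
  exact/isometry_comp/orthogonal_isometry/icosahedron_rotation_orthogonal.
rewrite -{2}icosahedron_rotation_stable image_comp image_comp.
apply: eq_imagel => x _ /=; rewrite TT' /=.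
by rewrite scalemxAl.
Qed.

End Icosahedron.

(** * Icosahedral symmetry does not descend to a torus *)

Theorem theorem4p9 (R : realType) (P : figure 'rV[R]_3)
    (P_regular : regular_polyhedron_E3 P) (P_finite : finite_figure P)
    (P_icosahedral : icosahedral_group (symmetry_group P)) :
  ~ exists L : zmodClosed 'rV[R]_3,
      rank3_lattice_group L /\ symmetric_toroidal_realization P L.
Proof.
case=> L [Llattice [_ _ [R0 [R1 [R2 [S0 [S1 [S2 [RG S_iso RS _]]]]]]]]].
have [genG _] := RG.
have sub_compat : symmetry_group P `<=` lattice_compatible L.
  rewrite -genG; apply: smallest_sub (lattice_compatible_group L) _ => S.
  case: S_iso => -[/bij_inj S0inj _] [/bij_inj S1inj _] [/bij_inj S2inj _].
  case: RS => RS0 RS1 RS2.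
  by move=> [[->|->]|->]; [exact: (induces_compatible S0inj)|
     exact: (induces_compatible S1inj)|exact: (induces_compatible S2inj)].
have [T [T' [Tiso T'K /sub_compat TMT']]] :=
  icosahedral_group_rotation P_icosahedral.
have [Q QQ TE] := isometry_affine Tiso.
have TB x y : T x - T y = (x - y) *m Q.
  by rewrite (TE x) (TE y) opprD addrACA subrr addr0 mulmxBl.
pose M := icosahedron_rotation R.
(* The linear part of the symmetry [T \o mulmxr M \o T'], read off from the
     difference between its values at [x] and at [0]. *)
have LM x : x \in L -> x *m (Q^T *m M *m Q) \in L.
  rewrite -{1}[x]subr0 -TMT' /= TB -mulmxBl.
  have -> : T' x - T' 0 = x *m Q^T.
    by rewrite -[LHS]mulmx1 -QQ mulmxA -TB !T'K subr0.
  by rewrite !mulmxA.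
have [k] := lattice_trace_int Llattice LM.
rewrite mxtrace_mulC mulmxA QQ mul1mx icosahedron_rotation_trace.
exact: golden_ratio_not_int.
Qed.
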